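(* Let $\mathcal{K}\subseteq\mathcal{L}$ be a set of gambles (the acceptable gambles) and let $\mathcal{S}\in\mathbb{M}$ be a background model with $0\in\mathcal{S}_{\mathrm{acc}}$. Then the assessment $\mathcal{M}=\langle\mathcal{K};\mathcal{S}_{\mathrm{rej}}-\mathcal{K}\rangle$ is a model without confusion that dominates $\mathcal{S}$ (i.e., $\mathcal{M}\in\mathbb{M}$ and $\mathcal{S}\subseteq\mathcal{M}$) if and only if all of the following hold: (A1) $\mathcal{S}_{\mathrm{acc}}\subseteq\mathcal{K}$; (A2) $0\notin\mathcal{S}_{\mathrm{rej}}-\mathcal{K}$; (A3) $\mathcal{K}$ is a cone.
   Context: Let $\Omega$ be a non-empty set and let $\mathcal{L}$ be a real linear subspace of the vector space of all real-valued functions (''gambles'') on $\Omega$ with pointwise operations. For subsets $\mathcal{G},\mathcal{G}'\subseteq\mathcal{L}$: $\mathcal{G}-\mathcal{G}'=\{f-g:f\in\mathcal{G},g\in\mathcal{G}'\}$ (empty if either set is empty); $\overline{\mathcal{G}}=\{\lambda f:\lambda>0,f\in\mathcal{G}\}$; $\operatorname{posi}\mathcal{G}$ is the set of all linear combinations with strictly positive coefficients of non-empty finite families of elements of $\mathcal{G}$ (so $\operatorname{posi}\emptyset=\emptyset$). A cone is a set $\mathcal{G}\subseteq\mathcal{L}$ with $\operatorname{posi}\mathcal{G}=\mathcal{G}$. An assessment is a pair $\mathcal{A}=\langle\mathcal{A}_{\mathrm{acc}};\mathcal{A}_{\mathrm{rej}}\rangle$ of subsets of $\mathcal{L}$; inclusion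 is component-wise. A model without confusion is an assessment $\mathcal{M}$ such that $\mathcal{M}_{\mathrm{acc}}\cap\mathcal{M}_{\mathrm{rej}}=\emptyset$, $\mathcal{M}_{\mathrm{acc}}$ is a cone, and $\overline{\mathcal{M}_{\mathrm{rej}}}\cup(\overline{\mathcal{M}_{\mathrm{rej}}}-\mathcal{M}_{\mathrm{acc}})\subseteq\mathcal{M}_{\mathrm{rej}}$. The set of these is $\mathbb{M}$. *)

(* Defs.v *)
From mathcomp Require Import all_boot all_order all_algebra.
From mathcomp Require Import all_classical all_reals.

Set Implicit Arguments.
Unset Strict Implicit.
Unset Printing Implicit Defensive.

Import GRing.Theory Num.Theory.
Local Open Scope classical_set_scope.
Local Open Scope ring_scope.

(* [R^o] is [R] as a module over itself; functions then inherit the pointwise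
   vector-space structure. *)
Notation gamble R Omega := (Omega -> R^o) (only parsing).

Section Gambles.
Variables (R : realType) (Omega : Type).
Implicit Types (L G H : set (gamble R Omega)).

(* [submod_closed] speaks about boolean membership [f \in L]; for a classical
   set this is the same as [L f]. *)
Definition linear_subspace L : Prop := submod_closed [in L].

Definition gdiff G H : set (gamble R Omega) := [set f - g | f in G & g in H].

Definition ray G : set (gamble R Omega) :=
  [set lam *: f | lam in [set r : R | 0 < r] & f in G].

(* Families indexed by ['I_n.+1], so that they are non-empty. *)
Definition posi G : set (gamble R Omega) :=
  [set f | exists (n : nat) (lam : 'I_n.+1 -> R) (g : 'I_n.+1 -> gamble R Omega),
     [/\ forall i, 0 < lam i, forall i, G (g i)
       & f = \sum_(i < n.+1) lam i *: g i]].

Definition cone L G : Prop := G `<=` L /\ posi G = G.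

(* The two components range over sets of arbitrary gambles; [is_assessment L]
   confines them to subsets of [L]. *)
Record assessment := Assessment {
  acc : set (gamble R Omega);
  rej : set (gamble R Omega) }.

Definition is_assessment L (A : assessment) : Prop :=
  acc A `<=` L /\ rej A `<=` L.

Definition dominates (B A : assessment) : Prop :=
  acc A `<=` acc B /\ rej A `<=` rej B.

Definition model_without_confusion L (M : assessment) : Prop :=
  [/\ is_assessment L M,
      acc M `&` rej M = set0,
      cone L (acc M)
    & ray (rej M) `|` gdiff (ray (rej M)) (acc M) `<=` rej M].

End Gambles.

(* Main.v *)
Require Import Defs.
From mathcomp Require Import all_boot all_order all_algebra.
From mathcomp Require Import all_classical all_reals.

Set Implicit Arguments.
Unset Strict Implicit.
Unset Printing Implicit Defensive.

Import GRing.Theory Num.Theory.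
Local Open Scope classical_set_scope.
Local Open Scope ring_scope.

(** If [K] contains [0], then [rej S] is contained in [rej S - K]; this is how
   [0 \in acc S] together with [acc S <= K] makes the assessment
   [<K; rej S - K>] dominate [S].

   The condition that [0] is not in [rej S - K] says that [K] and [rej S] are
   disjoint ([gdiff0P]).  It is necessary because a dominating model rejects
   all of [rej S].  It is sufficient for the absence of confusion because [K]
   is a cone: if [k = r - k'] with [k, k'] in [K] and [r] in [rej S], then
   [r = k + k'] is in [K] ([gdiff_disjoint_cone]).

   The closure of [rej S - K] under positive scaling and under subtraction of
   [K] comes from [lam (r - k) - k' = lam r - (lam k + k')], where [lam r]
   stays in [rej S] and [lam k + k'] stays in [K] ([ray_gdiff_cone] and
   [gdiff_gdiff_cone]). *)

Section ConeAndDifference.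
Variables (R : realType) (Omega : Type).
Implicit Types (L G H K : set (gamble R Omega)) (f g : gamble R Omega).

Lemma cone_scale L K (lam : R) f : cone L K -> 0 < lam -> K f -> K (lam *: f).
Proof.
move=> [_ posiK] lam_gt0 Kf; rewrite -posiK.
exists 0%N, (fun=> lam), (fun=> f); split=> //.
by rewrite big_ord1.
Qed.

Lemma cone_add L K f g : cone L K -> K f -> K g -> K (f + g).
Proof.
move=> [_ posiK] Kf Kg; rewrite -posiK.
exists 1%N, (fun=> 1), (fun i => if i == ord0 then f else g); split.
- by move=> i; exact: ltr01.
- by move=> i; case: ifP.
- by rewrite big_ord_recl big_ord1 !scale1r.
Qed.

Lemma gdiff_sub_subspace L G H :
  linear_subspace L -> G `<=` L -> H `<=` L -> gdiff G H `<=` L.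
Proof.
move=> [_ L_lin] GL HL _ [f Gf [g Hg <-]].
have := L_lin (-1) g f (mem_set (HL _ Hg)) (mem_set (GL _ Gf)).
by rewrite scaleN1r addrC => /set_mem.
Qed.

Lemma gdiff0P G H : gdiff G H 0 <-> G `&` H !=set0.
Proof.
split=> [[f Gf [g Hg /subr0_eq fg]]|[f [Gf Hf]]].
- by exists f; split=> //; rewrite fg.
- by exists f => //; exists f => //; rewrite subrr.
Qed.

Lemma sub_gdiff G H : H 0 -> G `<=` gdiff G H.
Proof. by move=> H0 f Gf; exists f => //; exists 0 => //; rewrite subr0. Qed.

Lemma gdiff_disjoint_cone L G K :
  cone L K -> ~ gdiff G K 0 -> K `&` gdiff G K = set0.
Proof.
move=> coneK nGK0; rewrite -subset0 => f [Kf [r Gr [k Kk rkf]]].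
apply/nGK0/gdiff0P; exists r; split=> //.
by rewrite -(subrK k r) rkf; exact: cone_add coneK Kf Kk.
Qed.

Lemma ray_gdiff_cone L G K :
  ray G `<=` G -> cone L K -> ray (gdiff G K) `<=` gdiff G K.
Proof.
move=> rayG coneK _ [lam lam_gt0 [_ [r Gr [k Kk <-]] <-]].
exists (lam *: r); first by apply: rayG; exists lam => //; exists r.
exists (lam *: k); first exact: cone_scale coneK lam_gt0 Kk.
by rewrite scalerBr.
Qed.

Lemma gdiff_gdiff_cone L G K :
  cone L K -> gdiff (gdiff G K) K `<=` gdiff G K.
Proof.
move=> coneK _ [_ [r Gr [k Kk <-]] [k' Kk' <-]].
exists r => //; exists (k + k'); first exact: cone_add coneK Kk Kk'.
by rewrite opprD addrA.
Qed.

End ConeAndDifference.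

Theorem theorem4p15 (R : realType) (Omega : Type) (L : set (gamble R Omega))
    (K : set (gamble R Omega)) (S : assessment R Omega)
    (Omega_nonempty : [set: Omega] !=set0)
    (L_subspace : linear_subspace L)
    (K_sub_L : K `<=` L)
    (S_model : model_without_confusion L S)
    (S_acc0 : acc S 0) :
  let M := Assessment K (gdiff (rej S) K) in
  (model_without_confusion L M /\ dominates M S) <->
  [/\ acc S `<=` K, ~ gdiff (rej S) K 0 & cone L K].
Proof.
have [[_ rejSL] _ _ rejS_closed] := S_model.
split=> [[[_ /= KrejM0 coneK _] [/= accSK rejSM]]|[accSK nrejSK0 coneK]].
  split=> // /gdiff0P[r [rejr Kr]].
  by rewrite -[False]/(set0 r) -KrejM0; split=> //; exact: rejSM.
have rayS : ray (rej S) `<=` rej S by move=> f rf; apply: rejS_closed; left.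
have rayM := ray_gdiff_cone rayS coneK.
split; last by split=> //=; exact/sub_gdiff/accSK.
split=> //=.
- by split=> //=; exact: gdiff_sub_subspace.
- exact: gdiff_disjoint_cone coneK nrejSK0.
- move=> f [/rayM//|[g /rayM Mg [k Kk <-]]].
  by apply: (gdiff_gdiff_cone coneK); exists g => //; exists k.
Qed.
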